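(* Let $m\geq 4$ be an integer and let $G$ be an $m$-free digraph. Then $\beta(G)\leq \frac{1}{m-2}\,\gamma(G)$.
   Context: All digraphs are finite, without loops and without parallel edges. A digraph $G$ is $m$-free if it has no directed cycle of length at most $m$. A digraph is acyclic if it has no directed cycle. $\beta(G)$ denotes the minimum size of a set $X\subseteq E(G)$ of edges such that $G-X$ is acyclic. $\gamma(G)$ denotes the number of unordered pairs $\{a,b\}$ of distinct vertices of $G$ such that neither $(a,b)$ nor $(b,a)$ is an edge of $G$. *)

(* Defs.v *)
From mathcomp Require Import all_boot.
From Stdlib Require Import ClassicalEpsilon.
Set Implicit Arguments. Unset Strict Implicit. Unset Printing Implicit Defensive.

(* A digraph: finite vertex type T with edge relation E, assumed irreflexive
   (no loops); parallel edges are impossible since E is a relation. *)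
Definition loopless (T : finType) (E : rel T) : Prop := forall x, ~~ E x x.

Definition dicycle (T : finType) (E : rel T) (s : seq T) : bool :=
  [&& s != [::], uniq s & cycle E s].

Definition m_free (T : finType) (E : rel T) (m : nat) : Prop :=
  forall s : seq T, dicycle E s -> m < size s.

Definition acyclic (T : finType) (E : rel T) : Prop :=
  forall s : seq T, ~~ dicycle E s.

Definition edge_set (T : finType) (E : rel T) : {set T * T} :=
  [set e | E e.1 e.2].

Definition del_edges (T : finType) (E : rel T) (X : {set T * T}) : rel T :=
  fun x y => E x y && ((x, y) \notin X).

Definition propb (P : Prop) : bool :=
  if excluded_middle_informative P then true else false.

(* beta(G): minimum size of an edge set X with G - X acyclic
   (the full edge set is always such a set, so #|edge_set E| is a valid default). *)
Definition beta (T : finType) (E : rel T) : nat :=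
  \big[minn/#|edge_set E|]_(X : {set T * T} |
      (X \subset edge_set E) && propb (acyclic (del_edges E X))) #|X|.

Definition gamma (T : finType) (E : rel T) : nat :=
  #|[set p : {set T} | (#|p| == 2) &&
      [forall a in p, forall b in p, ~~ E a b]]|.

(* Main.v *)
Require Import Defs.
From mathcomp Require Import all_boot.
From mathcomp Require Import zify.
Set Implicit Arguments. Unset Strict Implicit. Unset Printing Implicit Defensive.

(* Write k = m - 2.  By induction on the vertex set A it suffices to cut A into
   nonempty S and A \ S with k e(S, A \ S) at most the number of nonadjacent
   pairs between S and A \ S: delete the edges from S to A \ S and recurse.
   Candidates for the cut are the out-balls of radius j around w, 1 <= j <= k,
   with weight k + 1 - j, and the in-balls of radius j, 2 <= j <= k, with the
   same weight; radius 1 is left out there because out- and in-balls of radius 1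
   would count the same triples below.
   An edge (w, y) leaving the out-ball of radius j around x yields a geodesic
   triple d(x, w) = j, d(w, y) = 1, d(x, y) = j + 1, so x and y are
   nonadjacent, and by m-freeness this pair is separated by the out-balls around
   w of radius at most m - j and by the in-balls around w of radius between j
   and m - 1; symmetrically for in-balls.  With the weights above, for each
   triple (x, w, y) the separations outweigh the edges by the factor k, so some
   cut is good. *)

(** * Truncated distances in a digraph without short cycles *)

Section TruncatedDistance.

Variables (T : finType) (e : rel T) (m : nat).

(** Staying put is allowed, so walks of length at most [n] are meant and [reach] is monotone in
    [n]. *)
Fixpoint reach (n : nat) (x y : T) : bool :=
  if n is n'.+1 then [exists z, reach n' x z && ((z == y) || e z y)]
  else x == y.

Lemma reachS n x y : reach n x y -> reach n.+1 x y.
Proof. by move=> h /=; apply/existsP; exists y; rewrite h eqxx. Qed.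

Lemma reach_le n n' x y : n <= n' -> reach n x y -> reach n' x y.
Proof.
move=> le_nn' h; rewrite -(subnK le_nn').
by elim: (n' - n) => //= i IHi; apply: reachS.
Qed.

Lemma reachD i j x y :
  reach (i + j) x y = [exists z, reach i x z && reach j z y].
Proof.
elim: j y => [|j IHj] y; last rewrite addnS.
  rewrite addn0; apply/idP/existsP=> [h|[z /andP[h /eqP <-]] //].
  by exists y; rewrite h /=.
rewrite /=; apply/existsP/existsP => [[z /andP[]]|[z /andP[xz /existsP[t /andP[zt ty]]]]].
  rewrite IHj => /existsP[t /andP[xt tz]] zy.
  by exists t; rewrite xt; apply/existsP; exists z; rewrite tz.
by exists t; rewrite ty andbT IHj; apply/existsP; exists z; rewrite xz.
Qed.

Lemma reach_path n x y :
  reach n x y -> exists s, [/\ path e x s, last x s = y & size s <= n].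
Proof.
elim: n y => [|n IHn] y /=; first by move/eqP=> <-; exists [::].
case/existsP=> z /andP[/IHn[s [es <- le_s]] /orP[/eqP <-|ey]].
  by exists s; split=> //; apply: leqW.
by exists (rcons s y); rewrite rcons_path last_rcons size_rcons es ey.
Qed.

Hypothesis free : m_free e m.

(** The walk shortens to a simple path, and an edge back would close a cycle on at most [n.+1]
    vertices. *)
Lemma no_short_cycle n x y : reach n x y -> n < m -> ~~ e y x.
Proof.
move=> /reach_path[s [es <- le_s]] lt_nm; apply/negP => ex.
case: (shortenP es) ex => p ep up sub_ps ex.
have le_p : size p <= size s.
  by apply: uniq_leq_size => //; case/andP: up.
have /free : dicycle e (x :: p) by rewrite /dicycle up /= rcons_path ep ex.
by rewrite ltnS leqNgt (leq_ltn_trans le_p (leq_ltn_trans le_s lt_nm)).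
Qed.

(* Truncated: all distances larger than [m], infinite ones included, become [m.+1]. *)
Definition dist (x y : T) : nat := find (fun i => reach i x y) (iota 0 m.+1).

Lemma dist_max x y : dist x y <= m.+1.
Proof. by rewrite /dist (leq_trans (find_size _ _)) ?size_iota. Qed.

Lemma dist_le x y i : i <= m -> (dist x y <= i) = reach i x y.
Proof.
move=> le_im; apply/idP/idP => [le_di|h].
  have lt_d : dist x y < m.+1 by lia.
  apply: (reach_le le_di).
  have := @nth_find _ 0 (fun i => reach i x y) (iota 0 m.+1).
  by rewrite has_find size_iota nth_iota // => /(_ lt_d).
rewrite leqNgt; apply/negP=> /(before_find 0).
by rewrite nth_iota ?ltnS // h.
Qed.

Lemma dist_eq0 x y : (dist x y == 0) = (x == y).
Proof. by rewrite -leqn0 dist_le. Qed.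

Lemma dist_triangle x y z : dist x z <= dist x y + dist y z.
Proof.
have [le_m|lt_m] := leqP (dist x y + dist y z) m; last first.
  exact: leq_trans (dist_max _ _) lt_m.
have le1 := leq_trans (leq_addr _ _) le_m; have le2 := leq_trans (leq_addl _ _) le_m.
by rewrite dist_le // reachD; apply/existsP; exists y; rewrite -!dist_le ?leqnn.
Qed.

Lemma dist_eq1 x y : 0 < m -> (dist x y == 1) = e x y.
Proof.
move=> m_gt0; have -> : (dist x y == 1) = (dist x y <= 1) && ~~ (dist x y <= 0).
  by lia.
rewrite !dist_le //=; apply/andP/idP => [[/existsP[z /andP[/eqP <-]]]|exy].
  by case/orP => // ->.
split; first by apply/existsP; exists x; rewrite eqxx exy orbT.
apply/negP=> yx; move: exy; apply/negP.
by apply: (@no_short_cycle 0) => //=; rewrite eq_sym.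
Qed.

Lemma dist_cycle x y : x != y -> m < dist x y + dist y x.
Proof.
move=> neq_xy; rewrite ltnNge; apply/negP => le_m.
have xy : reach (dist x y) x y by rewrite -dist_le //; lia.
case def_n: (dist y x) => [|n].
  by move/eqP: def_n; rewrite dist_eq0 eq_sym (negbTE neq_xy).
have : reach n.+1 y x by rewrite -dist_le ?def_n //; lia.
(* By minimality of [dist y x] the last step is a real edge into [x]; the rest of the closed walk
   has length below [m]. *)
rewrite /= => /existsP[z /andP[yz]]; case/orP => [/eqP eq_zx|].
  by move: yz; rewrite eq_zx -dist_le ?def_n ?ltnn //; lia.
apply/negP/(@no_short_cycle (dist x y + n)); last by lia.
by rewrite reachD; apply/existsP; exists y; rewrite xy.
Qed.

End TruncatedDistance.

(** * Weighted sums over ball radii *)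

Section WeightedCounting.

Variables (T : finType) (k : nat).

(* [(x, y)] leaves the ball of radius [j] around [w]; taking the reversed distance
   for [d] gives the in-ball version. *)
Definition cut_edge (d : T -> T -> nat) j w x y : bool :=
  [&& d w x <= j, j < d w y & d x y == 1].

(* Here [x] is outside the ball and [y] inside; only pairs with finite [d x y] are needed. *)
Definition cut_nonedge (d : T -> T -> nat) j w x y : bool :=
  [&& j < d w x, d w y <= j, 1 < d x y, 1 < d y x & d x y <= k.+2].

(** An arithmetic series, doubled to avoid division; [a = n.+1] gives the empty range. *)
Lemma sum_weights (c : pred nat) a n :
    0 < a <= n.+1 -> n <= k -> (forall j, 0 < j <= k -> c j = (a <= j <= n)) ->
  (\sum_(1 <= j < k.+1 | c j) (k.+1 - j)).*2 = (n.+1 - a) * (k.*2.+2 - (a + n)).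
Proof.
move=> /andP[a_gt0 le_an] le_nk cE.
have -> : \sum_(1 <= j < k.+1 | c j) (k.+1 - j) = \sum_(a <= j < n.+1) (k.+1 - j).
  rewrite [RHS](big_nat_widenl _ 1) // [RHS](big_nat_widen _ _ k.+1) //.
  by apply: congr_big_nat => // j; rewrite ltnS => /cE ->; rewrite ltnS.
have [i def_n] : exists i, n.+1 = a + i by exists (n.+1 - a); lia.
elim: i n def_n le_nk {le_an cE} => [|i IHi] n def_n le_nk; first by rewrite big_geq; lia.
case: n => [|n] in def_n le_nk *; first by rewrite big_geq; lia.
by rewrite big_nat_recr /= ?doubleD ?(IHi n); [nia | lia | lia | lia].
Qed.

Variable d : T -> T -> nat.
Hypothesis d_triangle : forall x y z, d x z <= d x y + d y z.

(** By the triangle inequality the edge [(w, y)] can leave a ball around [x] only at radius [d x w],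
    so at most one term survives. *)
Lemma sum_cut_edge (c : pred nat) x w y :
  \sum_(1 <= j < k.+1 | c j) (k.+1 - j) * cut_edge d j x w y =
  (k.+1 - d x w) * [&& 0 < d x w <= k, c (d x w), d w y == 1 &
                     d x y == (d x w).+1].
Proof.
have [wy|nwy] := eqVneq (d w y) 1; last first.
  by rewrite !andbF muln0 big1 // => j _; rewrite /cut_edge (negbTE nwy) !andbF muln0.
have le_xy := d_triangle x w y.
have cutE j : cut_edge d j x w y = (j == d x w) && (d x y == (d x w).+1).
  by rewrite /cut_edge wy eqxx; lia.
under eq_bigr do rewrite cutE.
case: (d x y == _); last first.
  by rewrite !andbF muln0 big1 // => j _; rewrite andbF muln0.
rewrite big_mkcond /=.
have -> : \sum_(1 <= j < k.+1) (if c j then (k.+1 - j) * ((j == d x w) && true) else 0) =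
   \sum_(1 <= j < k.+1 | j == d x w) (if c j then (k.+1 - j) else 0).
  rewrite [RHS]big_mkcond; apply: eq_bigr => j _.
  by case: (c j); case: (j == _); rewrite /= ?muln0 ?muln1.
rewrite big_nat1_eq ltnS.
by case: (_ <= k); case: (0 < _); case: (c _); rewrite /= ?muln0 ?muln1.
Qed.

End WeightedCounting.

(** * Averaging over all balls *)

Section Averaging.

Variables (T : finType) (k : nat) (d : T -> T -> nat).
Hypothesis k_gt0 : 0 < k.
Hypothesis d_triangle : forall x y z, d x z <= d x y + d y z.
Hypothesis d_cycle : forall x y, x != y -> k.+2 < d x y + d y x.
Hypothesis d_eq0 : forall x y, (d x y == 0) = (x == y).

Let rd x y := d y x.

Lemma weighted_triple_le x w y :
  k * (\sum_(1 <= j < k.+1) (k.+1 - j) * cut_edge d j x w y +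
       \sum_(1 <= j < k.+1 | 1 < j) (k.+1 - j) * cut_edge rd j y w x)
  <= \sum_(1 <= j < k.+1) (k.+1 - j) * cut_nonedge k d j w x y +
     \sum_(1 <= j < k.+1 | 1 < j) (k.+1 - j) * cut_nonedge k rd j w y x.
Proof.
rewrite sum_cut_edge // sum_cut_edge; last by move=> *; rewrite addnC; apply: d_triangle.
rewrite /rd /=.
set p := d x w; set q := d w y; set r := d x y.
(* In all other cases no edge is counted: an out-ball edge needs [q = 1], an in-ball edge [p = 1],
   and both need a geodesic triple. *)
have [pq|not_triple] := boolP [&& 0 < p, 0 < q, p <= k, q <= k,
    (p == 1) || (q == 1) & r == p + q]; last first.
  set b1 := [&& _, _ & _]; have -> : b1 = false by rewrite /b1; lia.
  set b2 := [&& _, _, _ & _]; have -> : b2 = false by rewrite /b2; lia.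
  by rewrite !muln0.
have nexy : x != y by rewrite -d_eq0 -/r; lia.
have nexw : x != w by rewrite -d_eq0 -/p; lia.
have newy : w != y by rewrite -d_eq0 -/q; lia.
have := d_cycle nexy; have := d_cycle nexw; have := d_cycle newy.
rewrite -/p -/q -/r => c1 c2 c3.
(* By [d_cycle], [d w x > k.+2 - p], so out-balls of these radii separate [y] from [x]; in [high],
   dually, [d y w > k.+2 - q]. *)
have low : \sum_(1 <= j < k.+1 | q <= j <= k.+2 - p) (k.+1 - j) <=
           \sum_(1 <= j < k.+1) (k.+1 - j) * cut_nonedge k d j w x y.
  rewrite big_mkcond; apply: leq_sum => j _; case: ifP => // h.
  have -> : cut_nonedge k d j w x y by rewrite /cut_nonedge -/p -/q -/r; lia.
  by rewrite muln1.
have high : \sum_(1 <= j < k.+1 | (1 < j) && (p <= j <= k.+2 - q)) (k.+1 - j) <=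
           \sum_(1 <= j < k.+1 | 1 < j) (k.+1 - j) * cut_nonedge k rd j w y x.
  rewrite big_mkcondr; apply: leq_sum => j _; case: ifP => // h.
  have -> : cut_nonedge k rd j w y x by rewrite /cut_nonedge /rd -/p -/q -/r; lia.
  by rewrite muln1.
apply: leq_trans (leq_add low high) => {low high}.
have [q1|q_neq1] := eqVneq q 1.
  have -> : [&& 0 < p <= k, true & r == p.+1] by lia.
  have -> : [&& 0 < q <= k, 1 < q, p == 1 & r == q.+1] = false by lia.
  rewrite -leq_double doubleD muln0 addn0 muln1.
  (* For [p = 1] the bound [k.+2 - p] exceeds the largest radius [k]. The two sums are then k(k+1)/2
     and k(k-1)/2, together exactly the required [k * k]. *)
  have [p1|p_neq1] := eqVneq p 1.
    by rewrite (@sum_weights _ _ 1 k) 1?(@sum_weights _ _ 2 k); nia.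
  by rewrite (@sum_weights _ _ 1 (k.+2 - p)) 1?(@sum_weights _ _ p k); nia.
have p1 : p = 1 by lia.
have -> : [&& 0 < p <= k, false & r == p.+1] = false by lia.
have -> : [&& 0 < q <= k, 1 < q, p == 1 & r == q.+1] by lia.
rewrite -leq_double doubleD muln0 add0n muln1.
by rewrite (@sum_weights _ _ q k) 1?(@sum_weights _ _ 2 (k.+2 - q)); nia.
Qed.

Definition sum3 (g : T -> T -> T -> nat) := \sum_x \sum_w \sum_y g x w y.

Lemma sum3_rot g : sum3 g = sum3 (fun w x y => g x w y).
Proof. exact: exchange_big. Qed.

Lemma sum3_swap g : sum3 g = sum3 (fun x y w => g x w y).
Proof. by apply: eq_bigr => x _; apply: exchange_big. Qed.

Lemma sum3_le g h : (forall x w y, g x w y <= h x w y) -> sum3 g <= sum3 h.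
Proof. by move=> le_gh; do 3![apply: leq_sum => ? _]. Qed.

Lemma sum3D g h : sum3 (fun x w y => g x w y + h x w y) = sum3 g + sum3 h.
Proof.
rewrite /sum3 -big_split; apply: eq_bigr => x _; rewrite -big_split.
by apply: eq_bigr => w _; rewrite -big_split.
Qed.

Lemma sum3_weight (c l : nat -> _) (f : nat -> T -> T -> T -> bool) :
  sum3 (fun x w y => \sum_(1 <= j < k.+1 | c j) l j * f j x w y) =
  \sum_(1 <= j < k.+1 | c j) \sum_x l j * \sum_w \sum_y f j x w y.
Proof.
rewrite [RHS]exchange_big; apply: eq_bigr => x _.
under eq_bigr do rewrite exchange_big; rewrite exchange_big.
apply: eq_bigr => j _; rewrite big_distrr; apply: eq_bigr => w _.
by rewrite big_distrr.
Qed.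

Definition num_edges (d' : T -> T -> nat) j w := \sum_x \sum_y cut_edge d' j w x y.
Definition num_nonedges (d' : T -> T -> nat) j w :=
  \sum_x \sum_y cut_nonedge k d' j w x y.

Lemma averaging :
  k * (\sum_(1 <= j < k.+1) \sum_w (k.+1 - j) * num_edges d j w +
       \sum_(1 <= j < k.+1 | 1 < j) \sum_w (k.+1 - j) * num_edges rd j w)
  <= \sum_(1 <= j < k.+1) \sum_w (k.+1 - j) * num_nonedges d j w +
     \sum_(1 <= j < k.+1 | 1 < j) \sum_w (k.+1 - j) * num_nonedges rd j w.
Proof.
rewrite -!sum3_weight.
(* Reordering the sums puts the balls that count edges at the ends [x], [y] of the triple and those
   that count nonedges at its middle [w]. *)
rewrite [X in k * (_ + X)]sum3_swap [X in k * (_ + X)]sum3_rot [X in k * (_ + X)]sum3_swap.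
rewrite [X in _ <= X + _]sum3_rot.
rewrite [X in _ <= _ + X]sum3_swap [X in _ <= _ + X]sum3_rot.
rewrite -!sum3D.
have -> g : k * sum3 g = sum3 (fun x w y => k * g x w y).
  by rewrite /sum3 big_distrr; do 3![apply: eq_bigr => ? _; rewrite ?big_distrr].
by apply: sum3_le => x w y; apply: weighted_triple_le.
Qed.

Lemma le_weighted_sum (c : pred nat) (l : nat -> nat) (N M : nat -> T -> nat) a :
    (forall j w, 0 < j <= k -> N j w <= k * M j w) -> 0 < a ->
  \sum_(a <= j < k.+1 | c j) \sum_w l j * N j w <=
  k * \sum_(a <= j < k.+1 | c j) \sum_w l j * M j w.
Proof.
move=> le_NM a_gt0; rewrite big_distrr big_nat_cond [leqRHS]big_nat_cond.
apply: leq_sum => j /andP[/andP[le_aj lt_jk] _]; rewrite big_distrr.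
apply: leq_sum => w _; rewrite [leqRHS]mulnCA leq_mul2l le_NM ?orbT //.
by rewrite (leq_trans a_gt0 le_aj).
Qed.

Lemma lt_weighted_sum (l : nat) (N M : T -> nat) w0 :
    0 < l -> (forall w, N w <= k * M w) -> N w0 < k * M w0 ->
  \sum_w l * N w < k * \sum_w l * M w.
Proof.
move=> l_gt0 le_NM lt_w0; rewrite -!big_distrr mulnCA ltn_pmul2l // big_distrr /=.
rewrite (bigD1 w0) //= [X in _ < X](bigD1 w0) //= -addSn leq_add //.
by apply: leq_sum => w _; apply: le_NM.
Qed.

(* If no cut beats the ratio [k] strictly, then by averaging all of them attain it;
   radius 1 is singled out because some out-ball of radius 1 is a proper subset. *)
Lemma unit_ball_good_cut w0 :
    (forall j w, 0 < j <= k -> num_nonedges d j w <= k * num_edges d j w) ->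
    (forall j w, 0 < j <= k -> num_nonedges rd j w <= k * num_edges rd j w) ->
  k * num_edges d 1 w0 <= num_nonedges d 1 w0.
Proof.
move=> le_d le_rd; rewrite leqNgt; apply/negP => lt1.
have := averaging; rewrite leqNgt => /negP[].
rewrite mulnDr -addSn; apply: leq_add; last exact: le_weighted_sum.
rewrite big_ltn // [in X in _ <= X]big_ltn // mulnDr -addSn.
apply: leq_add; last exact: le_weighted_sum.
apply: lt_weighted_sum lt1; first by rewrite subSS subn0.
by move=> w; apply: le_d.
Qed.

End Averaging.

(** * Good cuts in induced subdigraphs *)

Section Cuts.

Variables (T : finType) (E : rel T) (k : nat).
Hypotheses (k_gt0 : 0 < k) (free : m_free E k.+2).

Lemma card_pairs (P : T -> T -> bool) :
  #|[set p : T * T | P p.1 p.2]| = \sum_x \sum_y P x y.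
Proof.
rewrite pair_bigA -sum1dep_card big_mkcond.
by apply: eq_bigr => p _; case: (P _ _).
Qed.

Definition edges_out (A S : {set T}) : {set T * T} :=
  [set p | [&& p.1 \in S, p.2 \in A :\: S & E p.1 p.2]].

Definition nonedges_out (A S : {set T}) : {set T * T} :=
  [set p | [&& p.1 \in S, p.2 \in A :\: S, ~~ E p.1 p.2 & ~~ E p.2 p.1]].

Lemma card_edges_out A S : #|edges_out A S| =
  \sum_x \sum_y [&& x \in S, y \in A :\: S & E x y].
Proof. exact: (card_pairs (fun x y => [&& x \in S, y \in A :\: S & E x y])). Qed.

Lemma card_nonedges_out A S : #|nonedges_out A S| =
  \sum_x \sum_y [&& x \in S, y \in A :\: S, ~~ E x y & ~~ E y x].
Proof.
exact: (card_pairs (fun x y => [&& x \in S, y \in A :\: S, ~~ E x y & ~~ E y x])).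
Qed.

Definition induced (A : {set T}) : rel T :=
  fun x y => [&& x \in A, y \in A & E x y].

Lemma m_free_induced A : m_free (induced A) k.+2.
Proof.
move=> s /and3P[s0 us cs]; apply: free; rewrite /dicycle s0 us.
by apply: sub_cycle cs => x y /and3P[].
Qed.

Lemma reach_induced A n x y :
  reach (induced A) n x y -> x != y -> (x \in A) && (y \in A).
Proof.
elim: n y => [|n IHn] y /=; first by move=> ->.
case/existsP=> z /andP[/IHn xz /orP[/eqP <- //|/and3P[Az Ay _]]] neq_xy.
by have [->|/xz/andP[-> _]] := eqVneq x z; rewrite ?Az Ay.
Qed.

(** If every nonempty proper subset failed, [unit_ball_good_cut] would apply and make a proper
    out-ball of radius 1 a good cut. *)
Lemma exists_cut (A : {set T}) : 1 < #|A| ->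
  exists S : {set T}, [/\ S != set0, S \proper A &
    k * #|edges_out A S| <= #|nonedges_out A S|].
Proof.
move=> A_gt1; pose good (S : {set T}) := [&& S != set0, S \proper A &
    k * #|edges_out A S| <= #|nonedges_out A S|].
case: (boolP [exists S, good S]) => [/existsP[S /and3P[]]|]; first by exists S.
move=> /existsPn bad; exfalso.
have lt_cut (S : {set T}) : S != set0 -> S \proper A ->
    #|nonedges_out A S| < k * #|edges_out A S|.
  by move=> S0 SA; have := bad S; rewrite /good S0 SA -ltnNge.
(* Balls may be empty or all of [A]; such cuts count nothing, so only the weak inequality covers
   them. *)
have le_cut (S : {set T}) : S \subset A -> #|nonedges_out A S| <= k * #|edges_out A S|.
  move=> sSA; have [->|S0] := eqVneq S set0.
    by rewrite (_ : nonedges_out A set0 = set0) ?cards0 //; apply/setP=> p; rewrite !inE.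
  have [->|neqSA] := eqVneq S A.
    rewrite (_ : nonedges_out A A = set0) ?cards0 //; apply/setP=> p; rewrite !inE.
    by case: (p.2 \in A); rewrite ?andbF.
  by apply/ltnW/lt_cut; rewrite // properEneq neqSA.
have freeA := @m_free_induced A.
pose d := dist (induced A) k.+2; pose rd x y := d y x.
have d_tri x y z : d x z <= d x y + d y z by apply: dist_triangle.
have d_cyc x y : x != y -> k.+2 < d x y + d y x by apply: dist_cycle.
have d0 x y : (d x y == 0) = (x == y) by apply: dist_eq0.
have d1 x y : (d x y == 1) = induced A x y by apply: dist_eq1.
(* Vertices outside [A] are isolated in [induced A], hence at truncated distance [k.+3] from all
   others. *)
have dA x y : 0 < d x y <= k.+2 -> (x \in A) && (y \in A).
  move=> /andP[d_gt0]; rewrite dist_le // => /reach_induced; apply.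
  by rewrite -d0 -lt0n.
have nonE x y j w : cut_nonedge k d j w x y ->
    [&& x \in A, y \in A, ~~ E x y & ~~ E y x].
  case/and5P=> _ _ xy yx le_xy.
  have /andP[Ax Ay] : (x \in A) && (y \in A) by apply: dA; rewrite le_xy ltnW.
  have := d1 x y; have := d1 y x; rewrite /induced Ax Ay /= => <- <-.
  by rewrite !neq_ltn xy yx !orbT.
pose ball j w := [set x in A | d w x <= j].
(* The complement of an in-ball: edges entering the in-ball are those leaving this set. *)
pose coball j w := [set x in A | j < d x w].
have sub_A (P : pred T) : [set x in A | P x] \subset A.
  by apply/subsetP=> x; rewrite inE => /andP[].
have edges_ball j w : num_edges d j w = #|edges_out A (ball j w)|.
  rewrite card_edges_out; apply: eq_bigr => x _; apply: eq_bigr => y _; congr nat_of_bool.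
  rewrite /cut_edge d1 /induced !inE.
  by case: (x \in A); case: (y \in A); rewrite ?andbF ?andbT //= -ltnNge.
have nonedges_ball j w : num_nonedges k d j w <= #|nonedges_out A (ball j w)|.
  rewrite card_nonedges_out exchange_big; apply: leq_sum => x _; apply: leq_sum => y _.
  case: (boolP (cut_nonedge _ _ _ _ _ _)) => // cut; rewrite lt0b.
  have /and4P[Ax Ay nxy nyx] := nonE _ _ _ _ cut; case/and5P: cut => wx wy _ _ _.
  by rewrite !inE Ax Ay wy /= -ltnNge wx nxy nyx.
have edges_coball j w : num_edges rd j w = #|edges_out A (coball j w)|.
  rewrite card_edges_out exchange_big.
  apply: eq_bigr => x _; apply: eq_bigr => y _; congr nat_of_bool.
  rewrite /cut_edge /rd d1 /induced !inE.
  by case: (x \in A); case: (y \in A); rewrite ?andbF ?andbT //= -leqNgt andbCA.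
have nonedges_coball j w : num_nonedges k rd j w <= #|nonedges_out A (coball j w)|.
  rewrite card_nonedges_out; apply: leq_sum => x _; apply: leq_sum => y _.
  case: (boolP (cut_nonedge _ _ _ _ _ _)) => // /and5P[wx wy xy yx le_xy]; rewrite lt0b.
  have /and4P[Ay Ax nyx nxy] : [&& y \in A, x \in A, ~~ E y x & ~~ E x y].
    have /andP[Ay Ax] : (y \in A) && (x \in A) by apply: dA; rewrite le_xy ltnW.
    have := d1 x y; have := d1 y x; rewrite /induced Ax Ay /= => <- <-.
    by rewrite -/(rd x y) -/(rd y x) !neq_ltn xy yx !orbT.
  by rewrite !inE Ax Ay wx /= -leqNgt wy nxy nyx.
(* There is no 2-cycle, so one direction is missing between two vertices of [A]; then [y] lies
   outside the radius 1 out-ball of [w0]. *)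
have [w0 [y [Aw Ay nwy neq_wy]]] : exists w y, [/\ w \in A, y \in A, ~~ E w y & w != y].
  have /card_gt1P[x [y [Ax Ay neq_xy]]] := A_gt1.
  have [xy|nxy] := boolP (E x y); last by exists x, y.
  exists y, x; rewrite eq_sym; split=> //; apply/negP => yx.
  have := d_cyc _ _ neq_xy.
  have /eqP-> : d x y == 1 by rewrite d1 /induced Ax Ay.
  by have /eqP-> : d y x == 1 by rewrite d1 /induced Ax Ay.
have sub_ball : ball 1 w0 \proper A.
  rewrite properE sub_A; apply/subsetPn; exists y => //.
  rewrite !inE Ay /= -ltnNge ltn_neqAle eq_sym d1 /induced Aw Ay nwy /=.
  by rewrite lt0n d0.
have ball0 : ball 1 w0 != set0.
  apply/set0Pn; exists w0; rewrite !inE Aw.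
  by have := d0 w0 w0; rewrite eqxx => /eqP->.
have := unit_ball_good_cut k_gt0 d_tri d_cyc d0 w0.
have le_d j w : 0 < j <= k -> num_nonedges k d j w <= k * num_edges d j w.
  move=> _; rewrite edges_ball (leq_trans (nonedges_ball j w)) // le_cut //.
  exact: sub_A.
have le_rd j w : 0 < j <= k -> num_nonedges k rd j w <= k * num_edges rd j w.
  move=> _; rewrite edges_coball (leq_trans (nonedges_coball j w)) // le_cut //.
  exact: sub_A.
move=> /(_ le_d le_rd); rewrite edges_ball leqNgt => /negP[].
exact: leq_ltn_trans (nonedges_ball 1 w0) (lt_cut _ ball0 sub_ball).
Qed.

(** * Gluing vertex rankings along cuts *)

Definition back_edges (r : T -> nat) (A : {set T}) : {set T * T} :=
  [set p | [&& p.1 \in A, p.2 \in A, E p.1 p.2 & r p.2 <= r p.1]].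

Definition nonadjacent (A : {set T}) : {set {set T}} :=
  [set p : {set T} | [&& p \subset A, #|p| == 2 &
      [forall a in p, forall b in p, ~~ E a b]]].

Lemma irreflexive_m_free x : ~~ E x x.
Proof.
apply/negP => Exx; have /free : dicycle E [:: x] by rewrite /dicycle /= Exx.
by [].
Qed.

Lemma nonadjacent_cut (A S : {set T}) : S \subset A ->
  #|nonadjacent S| + #|nonadjacent (A :\: S)| + #|nonedges_out A S|
    <= #|nonadjacent A|.
Proof.
move=> sSA; rewrite -[leqRHS](cardsID [set p : {set T} | p \subset S]) -addnA.
apply: leq_add.
  apply/subset_leq_card/subsetP => p; rewrite !inE => /and3P[pS -> ->].
  by rewrite (subset_trans pS sSA) pS.
rewrite -[leqRHS](cardsID [set p : {set T} | p \subset A :\: S]); apply: leq_add.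
  apply/subset_leq_card/subsetP => p; rewrite !inE => /and3P[pS p2 ->].
  rewrite p2 pS (subset_trans pS (subsetDl _ _)) !andbT.
  apply/negP => pS'; have : p \subset (A :\: S) :&: S by rewrite subsetI pS.
  rewrite setIC setDE setICA setICr setI0 subset0 => /eqP p0.
  by rewrite p0 cards0 in p2.
(* Forgetting the order of a crossing pair is injective, since only its first entry lies in [S]. *)
rewrite -(@card_in_imset _ _ (fun p => [set p.1; p.2])).
  apply/subset_leq_card/subsetP => q /imsetP[[x y]]; rewrite !inE /=.
  case/and4P=> Sx /andP[nSy Ay] nxy nyx ->.
  rewrite !subUset !sub1set !inE Sx (negbTE nSy) Ay (subsetP sSA _ Sx) /= cards2.
  have -> : x != y by apply: contraNneq nSy => <-.
  apply/forall_inP => a; rewrite !inE => /orP[]/eqP->; apply/forall_inP => b;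
    by rewrite !inE => /orP[]/eqP->; rewrite ?irreflexive_m_free.
move=> [x y] [x' y']; rewrite !inE /=.
case/and4P=> Sx /andP[nSy _] _ _ /and4P[Sx' /andP[nSy' _] _ _ /setP eq_xy].
have := eq_xy x; have := eq_xy y; rewrite !inE !eqxx orbT /=.
have /negbTE-> : y != x' by apply: contraNneq nSy => ->.
have /negbTE-> : x != y' by apply: contraNneq nSy' => <-.
by rewrite orbF => /esym/eqP -> /esym/eqP ->.
Qed.

(** A ranking encodes the deleted edges in a form that glues along a cut and makes acyclicity
    immediate. *)
Lemma exists_ranking (A : {set T}) :
  exists r, k * #|back_edges r A| <= #|nonadjacent A|.
Proof.
have [n] := ubnP #|A|; elim: n A => // n IHn A; rewrite ltnS => le_An.
have [A_le1|A_gt1] := leqP #|A| 1.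
  exists (fun _ => 0); rewrite (_ : back_edges _ _ = set0) ?cards0 ?muln0 //.
  apply/setP=> -[x y]; rewrite !inE /=; apply/and3P=> -[Ax Ay /andP[xy _]].
  have /card_le1_eqP/(_ x y Ax Ay) eq_xy := A_le1.
  by move: xy; rewrite eq_xy (negbTE (irreflexive_m_free _)).
have [S [S0 SA cutS]] := exists_cut A_gt1.
have ltS : #|S| < n by apply: leq_trans (proper_card SA) le_An.
have ltS' : #|A :\: S| < n.
  apply: leq_trans le_An; rewrite (cardsD A S) (setIidPr (proper_sub SA)).
  by rewrite -card_gt0 in S0; have := subset_leq_card (proper_sub SA); lia.
have [r1 le1] := IHn _ ltS; have [r2 le2] := IHn _ ltS'.
(* The shift ranks [S] above [A :\: S]: edges from [S] to [A :\: S] become back edges, those the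
   other way ascend. *)
exists (fun x => if x \in S then r1 x + (\max_z r2 z).+1 else r2 x).
apply: leq_trans (nonadjacent_cut (proper_sub SA)).
apply: leq_trans (leq_add (leq_add le1 le2) cutS).
rewrite -!mulnDr leq_mul2l; apply/orP; right.
apply: leq_trans (leq_trans (leq_card_setU _ _) (leq_add (leq_card_setU _ _) (leqnn _))).
apply/subset_leq_card/subsetP => -[x y]; rewrite !inE /=.
case/and4P=> -> -> ->; case: (x \in S); case: (y \in S) => //=.
- by rewrite leq_add2r => ->.
- move=> le_r; have := leq_bigmax (F := r2) x; lia.
- by move=> ->.
Qed.

End Cuts.

(** * From rankings to the bound on [beta] *)

Lemma bigminn_le (I : eqType) (s : seq I) (P : pred I) (F : I -> nat) n i :
  i \in s -> P i -> \big[minn/n]_(j <- s | P j) F j <= F i.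
Proof.
move=> s_i Pi; elim: s s_i => // j s IHs; rewrite inE big_cons.
case/predU1P => [<-|/IHs le_s]; first by rewrite Pi geq_minl.
by case: (P j) => //; apply: leq_trans (geq_minr _ _) le_s.
Qed.

(** Along a cycle [r] would increase strictly from a vertex back to itself. *)
Lemma acyclic_ranking (T : finType) (E : rel T) (r : T -> nat) :
  (forall x y, E x y -> r x < r y) -> acyclic E.
Proof.
move=> incr [|x s] //; apply/negP => /and3P[_ _].
move/(sub_cycle (e' := relpre r ltn) incr) => /=.
rewrite path_sortedE; last by move=> b a c; apply: ltn_trans.
by rewrite all_rcons /= ltnn.
Qed.

Theorem theorem1p4 (T : finType) (E : rel T) (m : nat) :
  loopless E -> 4 <= m -> m_free E m ->
  (m - 2) * beta E <= gamma E.
Proof.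
move=> _ m_ge4 free.
have [k_gt0 def_m] : 0 < m - 2 /\ (m - 2).+2 = m by lia.
rewrite -def_m in free.
have [r le_r] := exists_ranking k_gt0 free setT.
have -> : gamma E = #|nonadjacent E setT|.
  by rewrite /gamma; congr #|pred_of_set _|; apply/setP => p; rewrite !inE subsetT.
apply: leq_trans le_r; rewrite leq_mul2l; apply/orP; right.
(* The back edges of [r] serve as a candidate for the minimum in [beta]. *)
apply: bigminn_le; first exact: mem_index_enum.
apply/andP; split.
  by apply/subsetP => p; rewrite !inE => /and4P[].
rewrite /propb; case: ClassicalEpsilon.excluded_middle_informative => //= -[].
apply: (acyclic_ranking (r := r)) => x y /andP[xy].
by rewrite !inE xy /= -ltnNge.
Qed.
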